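(* Let $N^{+}(s)$ be the number of eigenvalues, counted with multiplicity, in $(0,s]$ of the wave operator $\Box=-\frac{\partial^2}{\partial t^2}+\frac{\partial^2}{\partial x^2}$ on $S^1\times S^1$; that is, $$N^{+}(s)=\#\{(j,k)\in\mathbb{Z}^2:\ 0<j^2-k^2\le s\}.$$ Then $$N^{+}(s)=s\log s+(2\gamma-1)s+R_{N^{+}}(s),\qquad R_{N^{+}}(s)=O(\sqrt{s})\quad\text{as } s\to\infty,$$ where $\gamma$ denotes Euler's constant.
   Context: $S^1=\mathbb{R}/2\pi\mathbb{Z}$. The eigenfunctions of $\Box$ are $e^{ijt}e^{ikx}$, $j,k\in\mathbb{Z}$, with eigenvalue $j^2-k^2$. *)

(* Defs.v *)
From Stdlib Require Import Reals ZArith List.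
From Coquelicot Require Import Coquelicot.

Open Scope R_scope.

(** Functions on [S^1 * S^1], [S^1 = R / 2 pi Z], are functions [u t x] on [R * R]
    that are [2 pi]-periodic in both variables. *)
Definition periodic (u : R -> R -> C) : Prop :=
  forall t x, u (t + 2 * PI) x = u t x /\ u t (x + 2 * PI) = u t x.

(** Partial derivatives of complex-valued functions; as with [Derive], the values
    are meaningful only where the derivative exists (see [of_class]). *)
Definition Dt (u : R -> R -> C) (t x : R) : C :=
  (Derive (fun t' => Re (u t' x)) t, Derive (fun t' => Im (u t' x)) t).

Definition Dx (u : R -> R -> C) (t x : R) : C :=
  (Derive (fun x' => Re (u t x')) x, Derive (fun x' => Im (u t x')) x).

Definition continuous_2d (u : R -> R -> C) : Prop :=
  forall t x, continuity_2d_pt (fun t x => Re (u t x)) t x /\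
              continuity_2d_pt (fun t x => Im (u t x)) t x.

Definition partially_derivable (u : R -> R -> C) : Prop :=
  forall t x,
    ex_derive (fun t' => Re (u t' x)) t /\ ex_derive (fun t' => Im (u t' x)) t /\
    ex_derive (fun x' => Re (u t x')) x /\ ex_derive (fun x' => Im (u t x')) x.

(** [of_class n u]: [u] is of class [C^n] on the plane. *)
Fixpoint of_class (n : nat) (u : R -> R -> C) : Prop :=
  match n with
  | O => continuous_2d u
  | S m => continuous_2d u /\ partially_derivable u /\
           of_class m (Dt u) /\ of_class m (Dx u)
  end.

Definition smooth_on_torus (u : R -> R -> C) : Prop :=
  periodic u /\ forall n, of_class n u.

Definition box (u : R -> R -> C) (t x : R) : C :=
  (- Dt (Dt u) t x + Dx (Dx u) t x)%C.

Definition eigenspace (lambda : R) (u : R -> R -> C) : Prop :=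
  smooth_on_torus u /\ forall t x, box u t x = (RtoC lambda * u t x)%C.

Definition eigenvalue (lambda : R) : Prop :=
  exists u, eigenspace lambda u /\ exists t x, u t x <> RtoC 0.

Definition lincomb (n : nat) (c : nat -> C) (b : nat -> R -> R -> C) (t x : R) : C :=
  fold_right Cplus (RtoC 0) (map (fun i => (c i * b i t x)%C) (seq 0 n)).

(** The complex vector space [E] has dimension [n]: [b 0, ..., b (n-1)] is a basis. *)
Definition has_dimension (E : (R -> R -> C) -> Prop) (n : nat) : Prop :=
  exists b : nat -> R -> R -> C,
    (forall i, (i < n)%nat -> E (b i)) /\
    (forall c : nat -> C, (forall t x, lincomb n c b t x = RtoC 0) ->
       forall i, (i < n)%nat -> c i = RtoC 0) /\
    (forall u, E u -> exists c : nat -> C, forall t x, u t x = lincomb n c b t x).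

(** [n] eigenvalues of [box], counted with multiplicity, lie in [(0, s]]: [l] lists
    the distinct ones and [m] gives their (finite) multiplicities. *)
Definition positive_eigenvalue_count (s : R) (n : nat) : Prop :=
  exists (l : list R) (m : R -> nat),
    NoDup l /\
    (forall lambda, In lambda l <-> (0 < lambda <= s /\ eigenvalue lambda)) /\
    (forall lambda, In lambda l -> has_dimension (eigenspace lambda) (m lambda)) /\
    n = list_sum (map m l).

Definition has_card {A : Type} (P : A -> Prop) (n : nat) : Prop :=
  exists l : list A, NoDup l /\ (forall a, In a l <-> P a) /\ length l = n.

Definition lattice_set (s : R) (p : Z * Z) : Prop :=
  0 < IZR (fst p) ^ 2 - IZR (snd p) ^ 2 <= s.

Definition euler_gamma : R :=
  real (Lim_seq (fun n => sum_n_m (fun k => / INR k) 1 n - ln (INR n))).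

(* Main.v *)
Require Import Defs.
From Stdlib Require Import Reals ZArith List.
From Stdlib Require Import Permutation FunctionalExtensionality Classical_Prop Lra Lia.
From Coquelicot Require Import Coquelicot.

Open Scope R_scope.

(** An eigenfunction of the wave operator on the torus is expanded in the real
    functions [cas j t * cas k x], [j] and [k] integers, where [cas k x] is
    [cos (k x) + sin (k x)] (Hartley's form of the trigonometric system).  They
    span the same space as the exponentials, and the rule [cas k' = k * cas (- k)]
    treats sines, cosines and constants alike.  Each of them is an eigenfunction
    for [j ^ 2 - k ^ 2] ([eigenspace_wave]).

    For [lambda > 0] these functions exhaust the eigenspace.  The [k]-th
    coefficient in [x] of a real eigenfunction [w] is a function [F] of [t] with
    [F'' = - (k ^ 2 + lambda) F]; being [2 * PI]-periodic it vanishes, unless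
    [k ^ 2 + lambda] is a square [j ^ 2], and then it is a combination of [cas j]
    and [cas (- j)] ([mode_coef]).  So [w] minus a finite combination has no
    harmonics in [x] and is zero, because trigonometric polynomials detect
    continuous functions ([no_harmonics_eq_0]).  Orthogonality makes the expansion
    unique, hence the multiplicity of [lambda] is the number of [(j, k)] with
    [j ^ 2 - k ^ 2 = lambda] ([eigenspace_dimension]), and counting eigenvalues is
    counting lattice points.

    Put [a = |j| - |k|], so that [j ^ 2 - k ^ 2 = a * (a + 2 * |k|)].  For fixed
    [a >= 1], [k] ranges over the integers with [2 * |k| <= s / a - a], and [j] has
    two possible signs.  This gives [2 * s / a - 2 * a + 2] points up to a bounded
    error, for each [a <= m], where [m] is the integer part of [sqrt s].  Summing,
    the number of points is [2 * s * H m - m ^ 2] up to [O(m)] ([count_estimate]),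
    and [H m = ln m + euler_gamma + O(1 / m)] ([harmonic_asymptotics]) turns this
    into the asserted expansion. *)

(** * Continuous functions and their integrals *)

(* [RInt] lives in an abstract normed module; [ring] needs the equation typed in [R]. *)
Ltac ring_R :=
  match goal with |- @eq _ ?a ?b => change (@eq R a b) end; ring.

Definition cont (f : R -> R) : Prop := forall x, continuous f x.

Lemma cont_const c : cont (fun _ => c).
Proof. intro x; apply continuous_const. Qed.

Lemma cont_plus f g : cont f -> cont g -> cont (fun x => f x + g x).
Proof. intros F G x; exact (continuous_plus f g x (F x) (G x)). Qed.

Lemma cont_opp f : cont f -> cont (fun x => - f x).
Proof. intros F x; exact (continuous_opp f x (F x)). Qed.

Lemma cont_minus f g : cont f -> cont g -> cont (fun x => f x - g x).
Proof. intros F G x; exact (continuous_minus f g x (F x) (G x)). Qed.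

Lemma cont_mult f g : cont f -> cont g -> cont (fun x => f x * g x).
Proof. intros F G x; exact (continuous_mult f g x (F x) (G x)). Qed.

Lemma cont_pow f n : cont f -> cont (fun x => f x ^ n).
Proof.
  intros F; induction n as [|n IH]; simpl; [apply cont_const|].
  now apply cont_mult.
Qed.

Lemma cont_derive (f f' : R -> R) : (forall x, is_derive f x (f' x)) -> cont f.
Proof.
  intros D x; apply (ex_derive_continuous (V := R_NormedModule)).
  exists (f' x); apply D.
Qed.

Lemma cont_ex_RInt f a b : cont f -> ex_RInt f a b.
Proof. intros F; apply (ex_RInt_continuous (V := R_CompleteNormedModule)); auto. Qed.

Lemma RInt_add f g a b : cont f -> cont g ->
  RInt (fun x => f x + g x) a b = RInt f a b + RInt g a b.
Proof.
  intros F G; exact (RInt_plus f g a b (cont_ex_RInt f a b F) (cont_ex_RInt g a b G)).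
Qed.

Lemma RInt_sub f g a b : cont f -> cont g ->
  RInt (fun x => f x - g x) a b = RInt f a b - RInt g a b.
Proof.
  intros F G; exact (RInt_minus f g a b (cont_ex_RInt f a b F) (cont_ex_RInt g a b G)).
Qed.

Lemma RInt_mulc c f a b : cont f ->
  RInt (fun x => c * f x) a b = c * RInt f a b.
Proof. intros F; exact (RInt_scal f a b c (cont_ex_RInt f a b F)). Qed.

Lemma RInt_Chasles_cont f a b c : cont f ->
  RInt f a b + RInt f b c = RInt f a c.
Proof. intros F; apply (RInt_Chasles f); now apply cont_ex_RInt. Qed.

Lemma RInt_ftc (F f : R -> R) a b :
  (forall x, is_derive F x (f x)) -> cont f -> RInt f a b = F b - F a.
Proof.
  intros D C; apply is_RInt_unique.
  apply (is_RInt_derive (V := R_CompleteNormedModule) F f); auto.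
Qed.

Lemma RInt_ext_all (f g : R -> R) a b : (forall x, f x = g x) -> RInt f a b = RInt g a b.
Proof. intros E; apply RInt_ext; auto. Qed.

(** * Finite sums of reals *)

Definition Rsum {A} (g : A -> R) (l : list A) : R := fold_right Rplus 0 (map g l).

Lemma Rsum_ext {A} (g h : A -> R) l : (forall a, In a l -> g a = h a) -> Rsum g l = Rsum h l.
Proof. intros H; unfold Rsum; f_equal; now apply map_ext_in. Qed.

Lemma Rsum_perm {A} (g : A -> R) l l' : Permutation l l' -> Rsum g l = Rsum g l'.
Proof.
  intros H; induction H; unfold Rsum in *; simpl; try lra.
Qed.

Lemma Rsum_filter {A} (g : A -> R) (f : A -> bool) l :
  (forall a, f a = false -> g a = 0) -> Rsum g l = Rsum g (filter f l).
Proof.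
  intros H; induction l as [|a l IH]; [reflexivity|].
  unfold Rsum in *; simpl; destruct (f a) eqn:E; simpl; rewrite IH; [ring|].
  rewrite (H a E); ring.
Qed.

Lemma Rsum_mulc {A} (g : A -> R) c l : Rsum (fun a => c * g a) l = c * Rsum g l.
Proof. induction l as [|a l IH]; unfold Rsum in *; simpl; [ring|rewrite IH; ring]. Qed.

Lemma cont_Rsum {A} (g : A -> R -> R) l : (forall a, cont (g a)) ->
  cont (fun x => Rsum (fun a => g a x) l).
Proof.
  intros H; induction l as [|a l IH]; [exact (cont_const 0)|].
  unfold Rsum in *; simpl; apply cont_plus; [apply H|exact IH].
Qed.

Lemma RInt_Rsum {A} (g : A -> R -> R) l a b : (forall i, cont (g i)) ->
  RInt (fun x => Rsum (fun i => g i x) l) a b = Rsum (fun i => RInt (g i) a b) l.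
Proof.
  intros H; induction l as [|i l IH].
  - unfold Rsum; simpl; rewrite RInt_const; unfold scal; simpl; unfold mult; simpl; ring_R.
  - transitivity (RInt (g i) a b + RInt (fun x => Rsum (fun i => g i x) l) a b).
    + apply (RInt_add (g i) (fun x => Rsum (fun i => g i x) l)); [apply H|now apply cont_Rsum].
    + rewrite IH; reflexivity.
Qed.

(** * The Hartley basis *)

Definition cas (k : Z) (x : R) : R := cos (IZR k * x) + sin (IZR k * x).

Lemma is_derive_cas k x : is_derive (cas k) x (IZR k * cas (- k) x).
Proof.
  unfold cas; auto_derive; [trivial|].
  rewrite opp_IZR, Ropp_mult_distr_l_reverse, cos_neg, sin_neg; ring.
Qed.

Lemma cont_cas k : cont (cas k).
Proof. apply (cont_derive _ _ (is_derive_cas k)). Qed.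

Lemma cas_0_l x : cas 0 x = 1.
Proof. unfold cas; rewrite Rmult_0_l, cos_0, sin_0; ring. Qed.

Lemma cas_0_r k : cas k 0 = 1.
Proof. unfold cas; rewrite Rmult_0_r, cos_0, sin_0; ring. Qed.

Lemma cos_sin_2PI_Z k : cos (IZR k * (2 * PI)) = 1 /\ sin (IZR k * (2 * PI)) = 0.
Proof.
  assert (H : sin (IZR k * PI) = 0) by (apply sin_eq_0_1; now exists k).
  replace (IZR k * (2 * PI)) with (2 * (IZR k * PI)) by ring.
  rewrite cos_2a_sin, sin_2a, H; split; ring.
Qed.

Lemma cas_periodic k x : cas k (x + 2 * PI) = cas k x.
Proof.
  unfold cas; rewrite Rmult_plus_distr_l, cos_plus, sin_plus.
  destruct (cos_sin_2PI_Z k) as [-> ->]; ring.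
Qed.

Lemma cas_sqr k x : cas k x ^ 2 + cas (- k) x ^ 2 = 2.
Proof.
  unfold cas; rewrite opp_IZR, Ropp_mult_distr_l_reverse, cos_neg, sin_neg.
  generalize (sin2_cos2 (IZR k * x)); unfold Rsqr; intros; nra.
Qed.

Lemma is_derive_cas_prod j k x :
  is_derive (fun x => cas j x * cas k x) x
    (IZR j * (cas (- j) x * cas k x) + IZR k * (cas j x * cas (- k) x)).
Proof.
  evar_last.
  - apply (is_derive_mult (cas j) (cas k)); [apply is_derive_cas..|].
    intros; apply Rmult_comm.
  - unfold plus, mult; simpl; ring.
Qed.

(** Integration by parts: [cas j] and [cas k] are eigenfunctions of the second derivative
    for the distinct eigenvalues [- j ^ 2] and [- k ^ 2]. *)
Lemma cas_orth_sqr j k : (j * j <> k * k)%Z ->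
  RInt (fun x => cas j x * cas k x) 0 (2 * PI) = 0.
Proof.
  intros H.
  assert (Hn : IZR k * IZR k - IZR j * IZR j <> 0).
  { rewrite <- !mult_IZR, <- minus_IZR; apply not_0_IZR; lia. }
  apply (Rmult_eq_reg_l (IZR k * IZR k - IZR j * IZR j)); [|exact Hn].
  rewrite Rmult_0_r, <- RInt_mulc by (apply cont_mult; apply cont_cas).
  rewrite (RInt_ftc (fun x => IZR j * (cas (- j) x * cas k x)
                            - IZR k * (cas j x * cas (- k) x))).
  - rewrite <- (Rplus_0_l (2 * PI)), !cas_periodic; ring.
  - intro x; evar_last.
    + apply (is_derive_minus (V := R_NormedModule)); apply is_derive_scal, is_derive_cas_prod.
    + unfold minus, plus, opp; simpl. rewrite !Z.opp_involutive, !opp_IZR; ring.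
  - apply cont_mult; [apply cont_const|apply cont_mult; apply cont_cas].
Qed.

(** The case that the eigenvalues do not separate; here [cas j * cas (- j)] is
    the derivative of [cas j ^ 2 / (2 * j)]. *)
Lemma cas_orth_opp j : j <> 0%Z -> RInt (fun x => cas j x * cas (- j) x) 0 (2 * PI) = 0.
Proof.
  intros H; apply not_0_IZR in H.
  apply (Rmult_eq_reg_l (2 * IZR j)); [|lra].
  rewrite Rmult_0_r, <- RInt_mulc by (apply cont_mult; apply cont_cas).
  rewrite (RInt_ftc (fun x => cas j x * cas j x)).
  - rewrite <- (Rplus_0_l (2 * PI)), !cas_periodic; ring.
  - intro x; evar_last; [apply is_derive_cas_prod|simpl; ring].
  - apply cont_mult; [apply cont_const|apply cont_mult; apply cont_cas].
Qed.

Lemma cas_orth j k : j <> k -> RInt (fun x => cas j x * cas k x) 0 (2 * PI) = 0.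
Proof.
  intros H; destruct (Z.eq_dec (j * j) (k * k)) as [E|E]; [|now apply cas_orth_sqr].
  assert (k = (- j)%Z) as -> by nia.
  apply cas_orth_opp; lia.
Qed.

(** [cas k * cas (- k)] has derivative [k * (cas (- k) ^ 2 - cas k ^ 2)], so the two
    squares have equal integrals; their sum is the constant [2]. *)
Lemma cas_norm k : RInt (fun x => cas k x * cas k x) 0 (2 * PI) = 2 * PI.
Proof.
  destruct (Z.eq_dec k 0) as [->|H].
  - rewrite (RInt_ext_all _ (fun _ => 1)) by (intro; rewrite cas_0_l; ring).
    rewrite RInt_const; unfold scal; simpl; unfold mult; simpl; ring.
  - assert (Hk := not_0_IZR _ H).
    assert (C : forall i, cont (fun x => cas i x * cas i x))
      by (intro; apply cont_mult; apply cont_cas).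
    apply (Rmult_eq_reg_l (2 * IZR k)); [|lra].
    rewrite <- RInt_mulc by apply C.
    (* [cas_sqr] turns [k * (cas k ^ 2 - cas (- k) ^ 2)] into [2 * k * cas k ^ 2 - 2 * k]. *)
    rewrite (RInt_ftc (fun x => 2 * IZR k * x - cas k x * cas (- k) x)).
    + rewrite <- (Rplus_0_l (2 * PI)), !cas_periodic; ring.
    + intro x; evar_last.
      * apply (is_derive_minus (V := R_NormedModule)).
        -- apply is_derive_scal, is_derive_id.
        -- apply is_derive_cas_prod.
      * unfold minus, plus, opp, one; simpl. rewrite !Z.opp_involutive, !opp_IZR.
        generalize (cas_sqr k x); intros E.
        replace (cas (- k) x * cas (- k) x) with (2 - cas k x ^ 2) by (rewrite <- E; ring).
        ring.
    + apply cont_mult; [apply cont_const|apply C].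
Qed.

(** * Uniqueness of Fourier coefficients *)

Lemma RInt_periodic f a : cont f -> (forall x, f (x + 2 * PI) = f x) ->
  RInt f a (a + 2 * PI) = RInt f 0 (2 * PI).
Proof.
  intros C P.
  assert (S : RInt f (2 * PI) (a + 2 * PI) = RInt f 0 a).
  { replace (2 * PI) with (1 * 0 + 2 * PI) at 1 by ring_R.
    replace (a + 2 * PI) with (1 * a + 2 * PI) by ring_R.
    rewrite <- (RInt_comp_lin f) by now apply cont_ex_RInt.
    apply RInt_ext_all; intro x; unfold scal; simpl; unfold mult; simpl.
    rewrite !Rmult_1_l; apply P. }
  rewrite <- (RInt_Chasles_cont f a 0) by exact C.
  rewrite <- (RInt_Chasles_cont f 0 (2 * PI) (a + 2 * PI)) by exact C.
  rewrite S, Rplus_comm, Rplus_assoc, (RInt_Chasles_cont f 0 a 0) by exact C.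
  rewrite RInt_point; unfold zero; simpl; ring_R.
Qed.

Definition no_harmonics (f : R -> R) : Prop :=
  forall k, RInt (fun x => f x * cas k x) 0 (2 * PI) = 0.

Lemma cas_mul_trig a b c k x :
  (a + b * cos x + c * sin x) * cas k x =
  a * cas k x + (b / 2) * cas (k + 1) x + (b / 2) * cas (k - 1) x
  + (c / 2) * cas (1 - k) x + (- c / 2) * cas (- k - 1) x.
Proof.
  unfold cas; rewrite !minus_IZR, plus_IZR, opp_IZR.
  replace ((IZR k + 1) * x) with (IZR k * x + x) by ring_R.
  replace ((IZR k - 1) * x) with (IZR k * x - x) by ring_R.
  replace ((1 - IZR k) * x) with (- (IZR k * x - x)) by ring_R.
  replace ((- IZR k - 1) * x) with (- (IZR k * x + x)) by ring_R.
  rewrite !cos_neg, !sin_neg, !cos_plus, !sin_plus, !cos_minus, !sin_minus.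
  field.
Qed.

Lemma cont_trig a b c : cont (fun x => a + b * cos x + c * sin x).
Proof.
  apply (cont_derive _ (fun x => - b * sin x + c * cos x)); intro x.
  auto_derive; [trivial|ring].
Qed.

(** Multiplying by [cos] or [sin] only shifts frequencies, by [cas_mul_trig].  Iterated, this
    replaces the remark that [f] is orthogonal to all trigonometric polynomials. *)
Lemma no_harmonics_mul f a b c : cont f -> no_harmonics f ->
  no_harmonics (fun x => f x * (a + b * cos x + c * sin x)).
Proof.
  intros C H k.
  assert (CF : forall r i, cont (fun x => r * (f x * cas i x))).
  { intros; apply cont_mult; [apply cont_const|]; apply cont_mult; [exact C|apply cont_cas]. }
  assert (Z : forall r i, RInt (fun x => r * (f x * cas i x)) 0 (2 * PI) = 0).
  { intros r i; rewrite RInt_mulc, H by (apply cont_mult; [exact C|apply cont_cas]); ring_R. }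
  rewrite (RInt_ext_all _ (fun x =>
      a * (f x * cas k x) + (b / 2) * (f x * cas (k + 1) x)
      + (b / 2) * (f x * cas (k - 1) x) + (c / 2) * (f x * cas (1 - k) x)
      + (- c / 2) * (f x * cas (- k - 1) x))).
  - rewrite !RInt_add by (repeat apply cont_plus; apply CF).
    rewrite !Z; ring_R.
  - intro x; rewrite Rmult_assoc, cas_mul_trig; ring_R.
Qed.

Lemma no_harmonics_mul_pow f a b c n : cont f -> no_harmonics f ->
  no_harmonics (fun x => f x * (a + b * cos x + c * sin x) ^ n).
Proof.
  intros C H; induction n as [|n IH]; intro k.
  - eapply eq_trans; [|apply (H k)]; apply RInt_ext_all; intro; simpl; ring_R.
  - assert (C' : cont (fun x => f x * (a + b * cos x + c * sin x) ^ n))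
      by (apply cont_mult; [exact C|apply cont_pow, cont_trig]).
    eapply eq_trans; [|apply (no_harmonics_mul _ a b c C' IH k)].
    apply RInt_ext_all; intro; simpl; ring_R.
Qed.

Lemma pow_bernoulli n y : 0 <= y -> 1 + INR n * y <= (1 + y) ^ n.
Proof.
  intros [H|<-]; [now apply poly|].
  rewrite Rplus_0_r, pow1; lra.
Qed.

Lemma Rabs_pow_le_1 y n : Rabs y <= 1 -> Rabs (y ^ n) <= 1.
Proof.
  intros H; rewrite <- RPow_abs, <- (pow1 n).
  apply pow_incr; split; [apply Rabs_pos|exact H].
Qed.

(** A trigonometric polynomial which exceeds [1] within distance [d] of [0] and is at
    most [1] in absolute value on the rest of the period: its powers concentrate near [0]. *)
Definition peak d y := 1 + cos y - cos d.

Lemma peak_mass_pos d : 0 < d < PI -> 0 < RInt (fun y => cos y - cos d) (- d) d.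
Proof.
  intros Hd.
  apply RInt_gt_0; [lra| |].
  - intros x Hx.
    destruct (Rle_or_lt 0 x).
    + generalize (cos_decreasing_1 x d); lra.
    + rewrite <- (cos_neg x); generalize (cos_decreasing_1 (- x) d); lra.
  - intros x _; apply (cont_derive _ (fun x => - sin x)); intro y.
    auto_derive; [trivial|ring].
Qed.

Lemma peak_out d y : 0 < d < PI -> d <= Rabs y <= PI -> Rabs (peak d y) <= 1.
Proof.
  intros Hd Hy.
  assert (E : cos y = cos (Rabs y)).
  { unfold Rabs; destruct Rcase_abs; [now rewrite cos_neg|reflexivity]. }
  assert (cos (Rabs y) <= cos d).
  { destruct (Rle_lt_or_eq_dec d (Rabs y)) as [L|<-]; [tauto| |lra].
    left; apply cos_decreasing_1; lra. }
  generalize (COS_bound d) (COS_bound y); unfold peak; rewrite E in *.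
  intros; apply Rabs_le; lra.
Qed.

Lemma peak_in d y : 0 < d < PI -> Rabs y <= d -> 0 <= cos y - cos d.
Proof.
  intros Hd Hy.
  assert (E : cos y = cos (Rabs y)).
  { unfold Rabs; destruct Rcase_abs; [now rewrite cos_neg|reflexivity]. }
  rewrite E.
  destruct (Rle_lt_or_eq_dec (Rabs y) d) as [L| ->]; [exact Hy| |lra].
  generalize (cos_decreasing_1 (Rabs y) d) (Rabs_pos y); lra.
Qed.

Lemma cont_bounded g a b : a <= b -> cont g ->
  exists M, forall x, a <= x <= b -> Rabs (g x) <= M.
Proof.
  intros L C.
  destruct (continuity_ab_maj (fun x => Rabs (g x)) a b L) as [m [Hm _]].
  - intros x _; apply continuity_pt_filterlim.
    apply (continuous_comp g Rabs); [apply C|apply continuous_Rabs].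
  - exists (Rabs (g m)); exact Hm.
Qed.

Lemma cont_pos_nbhd g : cont g -> 0 < g 0 ->
  exists d, 0 < d < PI /\ forall y, Rabs y <= d -> g 0 / 2 <= g y.
Proof.
  intros C P.
  assert (H : 0 < g 0 / 2) by lra.
  destruct (proj1 (filterlim_locally g (g 0)) (C 0) (mkposreal _ H)) as [e He].
  exists (Rmin (e / 2) 1).
  generalize (cond_pos e) PI2_1; intros He0 HPI.
  split.
  - split; [apply Rmin_glb_lt; lra|]. eapply Rle_lt_trans; [apply Rmin_r|lra].
  - intros y Hy.
    assert (B : Rabs (g y - g 0) < g 0 / 2).
    { apply He; change (Rabs (y - 0) < e). rewrite Rminus_0_r.
      generalize (Rmin_l (e / 2) 1); lra. }
    apply Rabs_def2 in B; lra.
Qed.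

(** Outside [[- d, d]] the powers of the peak stay bounded, and inside Bernoulli's
    inequality makes the integral grow at least linearly in [n]. *)
Lemma peak_integral_lower g : cont g -> 0 < g 0 ->
  exists d A B, 0 < A /\
    forall n, INR n * A - B <= RInt (fun y => g y * peak d y ^ n) (- PI) PI.
Proof.
  intros C P.
  destruct (cont_pos_nbhd g C P) as [d [Hd Hg]].
  destruct (cont_bounded g (- PI) PI) as [M HM]; [generalize PI_RGT_0; lra|exact C|].
  set (J := RInt (fun y => cos y - cos d) (- d) d).
  assert (HJ : 0 < J) by now apply peak_mass_pos.
  exists d, (g 0 / 2 * J), (2 * PI * M).
  split; [apply Rmult_lt_0_compat; lra|].
  intro n.
  assert (CP : cont (peak d)).
  { apply (cont_derive _ (fun x => - sin x)); intro y; unfold peak.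
    auto_derive; [trivial|ring]. }
  assert (CC : cont (fun y => cos y - cos d)).
  { apply (cont_derive _ (fun x => - sin x)); intro y.
    auto_derive; [trivial|ring]. }
  set (h := fun y => g y * peak d y ^ n).
  assert (Ch : cont h) by (apply cont_mult; [exact C|now apply cont_pow]).
  assert (M0 : 0 <= M) by (eapply Rle_trans; [apply Rabs_pos|apply (HM 0); lra]).
  assert (Out : forall y, - PI <= y <= PI -> d <= Rabs y -> Rabs (h y) <= M).
  { intros y Hy Hy'; unfold h; rewrite Rabs_mult.
    rewrite <- (Rmult_1_r M).
    apply Rmult_le_compat; [apply Rabs_pos|apply Rabs_pos|now apply HM|].
    apply Rabs_pow_le_1, peak_out; [exact Hd|split; [exact Hy'|apply Rabs_le; lra]]. }
  assert (L : Rabs (RInt h (- PI) (- d)) <= (- d - - PI) * M).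
  { apply abs_RInt_le_const; [lra|now apply cont_ex_RInt|].
    intros t Ht; apply Out; [lra|]. rewrite Rabs_left; lra. }
  assert (R' : Rabs (RInt h d PI) <= (PI - d) * M).
  { apply abs_RInt_le_const; [lra|now apply cont_ex_RInt|].
    intros t Ht; apply Out; [lra|]. rewrite Rabs_pos_eq; lra. }
  assert (I : INR n * (g 0 / 2 * J) <= RInt h (- d) d).
  { rewrite <- Rmult_assoc; unfold J.
    rewrite <- RInt_mulc by exact CC.
    apply RInt_le; [lra|apply cont_ex_RInt|apply cont_ex_RInt, Ch|].
    { apply cont_mult; [apply cont_const|exact CC]. }
    intros y Hy; unfold h.
    assert (Ay : Rabs y <= d) by (apply Rabs_le; lra).
    generalize (peak_in d y Hd Ay) (Hg y Ay); intros Q G.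
    generalize (pow_bernoulli n _ Q) (pos_INR n); intros Bn Nn.
    replace (peak d y) with (1 + (cos y - cos d)) by (unfold peak; ring_R).
    apply Rle_trans with (g 0 / 2 * (1 + INR n * (cos y - cos d))); [nra|].
    apply Rmult_le_compat; [lra| |exact G|exact Bn].
    generalize (Rmult_le_pos _ _ Nn Q); lra. }
  rewrite <- (RInt_Chasles_cont h (- PI) (- d) PI), <- (RInt_Chasles_cont h (- d) d PI) by exact Ch.
  apply Rabs_le_between in L; apply Rabs_le_between in R'.
  nra.
Qed.

(** The integrals of [f] against the powers of the peak centred at [x0] all vanish, while they
    would tend to infinity if [f x0] were positive. *)
Lemma no_harmonics_not_pos f x0 : cont f -> (forall x, f (x + 2 * PI) = f x) ->
  no_harmonics f -> ~ 0 < f x0.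
Proof.
  intros C P H Pos.
  set (g := fun y => f (y + x0)).
  assert (Cg : cont g).
  { intro y; unfold g. apply (continuous_comp (fun y => y + x0) f); [|apply C].
    apply (cont_plus (fun y => y) (fun _ => x0)); [intro; apply continuous_id|apply cont_const]. }
  destruct (peak_integral_lower g Cg) as (d & A & B & HA & Hn).
  { unfold g; now rewrite Rplus_0_l. }
  assert (Zero : forall n, RInt (fun y => g y * peak d y ^ n) (- PI) PI = 0).
  { intro n.
    (* The peak centred at [x0], expanded by the addition formula. *)
    set (q := fun x => f x * ((1 - cos d) + cos x0 * cos x + sin x0 * sin x) ^ n).
    assert (Cq : cont q) by (apply cont_mult; [exact C|apply cont_pow, cont_trig]).
    assert (E : RInt (fun y => g y * peak d y ^ n) (- PI) PI
                = RInt q (x0 - PI) (x0 - PI + 2 * PI)).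
    { replace (x0 - PI) with (1 * - PI + x0) by ring_R.
      replace (1 * - PI + x0 + 2 * PI) with (1 * PI + x0) by ring_R.
      rewrite <- (RInt_comp_lin q) by now apply cont_ex_RInt.
      apply RInt_ext_all; intro y; unfold scal; simpl; unfold mult; simpl.
      unfold q, g, peak; rewrite !Rmult_1_l.
      replace y with ((y + x0) - x0) at 2 by ring; rewrite cos_minus.
      f_equal; f_equal; ring_R. }
    rewrite E, RInt_periodic; [|exact Cq|].
    - eapply eq_trans;
        [|apply (no_harmonics_mul_pow f (1 - cos d) (cos x0) (sin x0) n C H 0%Z)].
      apply RInt_ext_all; intro; unfold q; rewrite cas_0_l; ring_R.
    - intro x; unfold q; rewrite P, cos_plus, sin_plus, cos_2PI, sin_2PI.
      f_equal; f_equal; ring_R. }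
  destruct (INR_unbounded (B / A)) as [n Hb].
  specialize (Hn n); rewrite Zero in Hn.
  apply (Rmult_lt_compat_r A) in Hb; [|exact HA].
  unfold Rdiv in Hb; rewrite Rmult_assoc, Rinv_l, Rmult_1_r in Hb by lra.
  lra.
Qed.

Lemma no_harmonics_eq_0 f : cont f -> (forall x, f (x + 2 * PI) = f x) ->
  no_harmonics f -> forall x, f x = 0.
Proof.
  intros C P H x.
  assert (C' : cont (fun x => - f x)) by now apply cont_opp.
  assert (~ 0 < - f x).
  { apply (no_harmonics_not_pos (fun x => - f x)); [exact C'| |].
    - intro y; now rewrite P.
    - intro k; rewrite (RInt_ext_all _ (fun x => -1 * (f x * cas k x))) by (intro; ring_R).
      rewrite RInt_mulc, H by (apply cont_mult; [exact C|apply cont_cas]); ring_R. }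
  generalize (no_harmonics_not_pos f x C P H); lra.
Qed.

(** * Fourier coefficients of a real eigenfunction *)

Lemma derive_0_const (f : R -> R) : (forall t, is_derive f t 0) -> forall t, f t = f 0.
Proof.
  intros D t; destruct (Rtotal_order t 0) as [L|[->|L]]; [|reflexivity|].
  - apply (eq_is_derive (V := R_NormedModule) f); [intros; apply D|exact L].
  - symmetry; apply (eq_is_derive (V := R_NormedModule) f); [intros; apply D|exact L].
Qed.

Lemma is_derive_mult_R (f g : R -> R) x f' g' : is_derive f x f' -> is_derive g x g' ->
  is_derive (fun x => f x * g x) x (f' * g x + f x * g').
Proof. intros F G; apply (is_derive_mult f g x f' g' F G); intros; apply Rmult_comm. Qed.

(** Both [w * F * cos - G * sin] and [w * F * sin + G * cos], taken at [w * t], have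
    derivative zero; eliminating [G] gives the formula. *)
Lemma oscillator (F G : R -> R) w : 0 < w ->
  (forall t, is_derive F t (G t)) -> (forall t, is_derive G t (- w ^ 2 * F t)) ->
  forall t, F t = F 0 * cos (w * t) + G 0 / w * sin (w * t).
Proof.
  intros Hw DF DG.
  assert (Dc : forall t, is_derive (fun t => cos (w * t)) t (- w * sin (w * t)))
    by (intro; auto_derive; [trivial|ring]).
  assert (Ds : forall t, is_derive (fun t => sin (w * t)) t (w * cos (w * t)))
    by (intro; auto_derive; [trivial|ring]).
  assert (E1 : forall t, w * (F t * cos (w * t)) - G t * sin (w * t) = w * F 0).
  { intro t; rewrite (derive_0_const (fun t => w * (F t * cos (w * t)) - G t * sin (w * t))).
    - rewrite Rmult_0_r, cos_0, sin_0; ring.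
    - intro s; evar_last.
      + apply (is_derive_minus (V := R_NormedModule)).
        * apply is_derive_scal, is_derive_mult_R; [apply DF|apply Dc].
        * apply is_derive_mult_R; [apply DG|apply Ds].
      + unfold minus, plus, opp; simpl; ring. }
  assert (E2 : forall t, w * (F t * sin (w * t)) + G t * cos (w * t) = G 0).
  { intro t; rewrite (derive_0_const (fun t => w * (F t * sin (w * t)) + G t * cos (w * t))).
    - rewrite Rmult_0_r, cos_0, sin_0; ring.
    - intro s; evar_last.
      + apply (is_derive_plus (V := R_NormedModule)).
        * apply is_derive_scal, is_derive_mult_R; [apply DF|apply Ds].
        * apply is_derive_mult_R; [apply DG|apply Dc].
      + unfold plus; simpl; ring. }
  intro t; apply (Rmult_eq_reg_l w); [|lra].
  replace (w * (F 0 * cos (w * t) + G 0 / w * sin (w * t)))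
    with (w * F 0 * cos (w * t) + G 0 * sin (w * t)) by (field; lra).
  rewrite <- (E1 t), <- (E2 t).
  transitivity (w * F t * ((sin (w * t))² + (cos (w * t))²));
    [rewrite sin2_cos2; ring|unfold Rsqr; ring].
Qed.

(** By [oscillator], equality of the values at [t + PI] and [t - PI] says that
    [sin (w * PI)] times a phase-shifted solution vanishes for all [t]; and
    [sin (w * PI)] is zero only when [w] is an integer. *)
Lemma oscillator_periodic (F G : R -> R) w : 0 < w ->
  (forall t, is_derive F t (G t)) -> (forall t, is_derive G t (- w ^ 2 * F t)) ->
  (forall t, F (t + 2 * PI) = F t) ->
  (forall j, IZR j <> w) -> forall t, F t = 0.
Proof.
  intros Hw DF DG P NI.
  assert (S : forall t, F t = F 0 * cos (w * t) + G 0 / w * sin (w * t))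
    by now apply oscillator.
  assert (N : sin (w * PI) <> 0).
  { intros Z; apply sin_eq_0_0 in Z; destruct Z as [j Hj].
    apply (NI j); apply (Rmult_eq_reg_r PI); [now rewrite Hj|apply PI_neq0]. }
  (* The values at [t - PI] and [t + PI] agree, and [sin (w * PI)] factors out. *)
  assert (D : forall t, F 0 * sin (w * t) = G 0 / w * cos (w * t)).
  { intro t; generalize (P (t - PI)).
    replace (t - PI + 2 * PI) with (t + PI) by ring.
    rewrite (S (t + PI)), (S (t - PI)), Rmult_plus_distr_l, Rmult_minus_distr_l.
    rewrite cos_plus, cos_minus, sin_plus, sin_minus; intros E.
    apply (Rmult_eq_reg_l (2 * sin (w * PI))); [lra|].
    apply Rmult_integral_contrapositive_currified; [lra|exact N]. }
  assert (B : G 0 / w = 0).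
  { generalize (D 0); rewrite Rmult_0_r, cos_0, sin_0; lra. }
  assert (A : F 0 = 0).
  { generalize (D (PI / 2 / w)); replace (w * (PI / 2 / w)) with (PI / 2) by (field; lra).
    rewrite sin_PI2, cos_PI2; lra. }
  intro t; rewrite S, A, B; ring.
Qed.

Lemma continuity_2d_snd f t x : continuity_2d_pt f t x -> continuous (f t) x.
Proof.
  intros C; apply continuity_2d_pt_filterlim in C.
  apply (filterlim_comp _ _ _ (fun x => (t, x)) (fun z => f (fst z) (snd z)) _
           (locally (t, x))); [|exact C].
  intros Q [e He]; exists e; intros y Hy; apply He; split; [apply ball_center|exact Hy].
Qed.

Lemma continuity_2d_proj2 f t x : continuous f x -> continuity_2d_pt (fun _ y => f y) t x.
Proof.
  intros C; apply (continuity_1d_2d_pt_comp f (fun _ y => y)).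
  - now apply continuity_pt_filterlim.
  - apply continuity_2d_pt_id2.
Qed.

Lemma continuity_2d_proj1 f t x : continuous f t -> continuity_2d_pt (fun s _ => f s) t x.
Proof.
  intros C; apply (continuity_1d_2d_pt_comp f (fun s _ => s)).
  - now apply continuity_pt_filterlim.
  - apply continuity_2d_pt_id1.
Qed.

Lemma derive_periodic (f f' : R -> R) T : (forall x, is_derive f x (f' x)) ->
  (forall x, f (x + T) = f x) -> forall x, f' (x + T) = f' x.
Proof.
  intros D P x.
  rewrite <- (is_derive_unique f x (f' x) (D x)).
  symmetry; apply is_derive_unique.
  apply (is_derive_ext (fun x => f (x + T))); [exact P|].
  evar_last.
  - apply (is_derive_comp f (fun x => x + T)); [apply D|].
    apply (is_derive_plus (V := R_NormedModule) (fun x => x) (fun _ => T));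
      [apply is_derive_id|apply is_derive_const].
  - unfold scal, plus, one, zero; simpl; unfold mult; simpl; ring.
Qed.

Definition coef (k : Z) (w : R -> R -> R) (t : R) : R :=
  RInt (fun x => w t x * cas k x) 0 (2 * PI).

Lemma is_derive_coef k (w wt : R -> R -> R) t :
  (forall t x, is_derive (fun t => w t x) t (wt t x)) ->
  (forall t x, continuity_2d_pt wt t x) ->
  (forall t, cont (w t)) ->
  is_derive (coef k w) t (coef k wt t).
Proof.
  intros D C2 C.
  assert (Dk : forall t x, is_derive (fun t => w t x * cas k x) t (wt t x * cas k x)).
  { intros s x; evar_last.
    - apply is_derive_mult_R; [apply D|apply is_derive_const].
    - unfold zero; simpl; ring. }
  evar_last.
  - apply (is_derive_RInt_param (fun t x => w t x * cas k x) 0 (2 * PI) t).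
    + apply filter_forall; intros s x _; exists (wt s x * cas k x); apply Dk.
    + intros x _; apply (continuity_2d_pt_ext (fun t x => wt t x * cas k x)).
      * intros s y; symmetry; apply is_derive_unique, Dk.
      * apply continuity_2d_pt_mult; [apply C2|apply continuity_2d_proj2, cont_cas].
    + apply filter_forall; intros s; apply cont_ex_RInt, cont_mult; [apply C|apply cont_cas].
  - apply RInt_ext_all; intro x; apply is_derive_unique, Dk.
Qed.

(** The analytic content of being a real solution on the torus, with the partial derivatives
    named; the real and the imaginary part of an eigenfunction satisfy it
    ([eigenspace_real_mode]). *)
Record real_mode (lambda : R) (w wt wtt wx wxx : R -> R -> R) : Prop := {
  mode_periodic_t : forall t x, w (t + 2 * PI) x = w t x;
  mode_periodic_x : forall t x, w t (x + 2 * PI) = w t x;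
  mode_t : forall t x, is_derive (fun t => w t x) t (wt t x);
  mode_tt : forall t x, is_derive (fun t => wt t x) t (wtt t x);
  mode_x : forall t x, is_derive (w t) x (wx t x);
  mode_xx : forall t x, is_derive (wx t) x (wxx t x);
  mode_t_cont : forall t x, continuity_2d_pt wt t x;
  mode_tt_cont : forall t x, continuity_2d_pt wtt t x;
  mode_xx_cont : forall t x, continuity_2d_pt wxx t x;
  mode_eq : forall t x, - wtt t x + wxx t x = lambda * w t x }.

Arguments mode_periodic_t {lambda w wt wtt wx wxx}.
Arguments mode_periodic_x {lambda w wt wtt wx wxx}.
Arguments mode_t {lambda w wt wtt wx wxx}.
Arguments mode_tt {lambda w wt wtt wx wxx}.
Arguments mode_x {lambda w wt wtt wx wxx}.
Arguments mode_xx {lambda w wt wtt wx wxx}.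
Arguments mode_t_cont {lambda w wt wtt wx wxx}.
Arguments mode_tt_cont {lambda w wt wtt wx wxx}.
Arguments mode_xx_cont {lambda w wt wtt wx wxx}.
Arguments mode_eq {lambda w wt wtt wx wxx}.

Section Mode.
Context {lambda : R} {w wt wtt wx wxx : R -> R -> R}
  (M : real_mode lambda w wt wtt wx wxx).

Lemma mode_cont t : cont (w t).
Proof. apply (cont_derive _ (wx t)), (mode_x M). Qed.

(** Two integrations by parts at once; the boundary terms cancel by periodicity. *)
Lemma coef_xx k t : coef k wxx t = - IZR k ^ 2 * coef k w t.
Proof.
  assert (Cw : cont (fun x => w t x * cas k x))
    by (apply cont_mult; [apply mode_cont|apply cont_cas]).
  assert (Cx : cont (fun x => wxx t x * cas k x)).
  { apply cont_mult; [intro; apply continuity_2d_snd, (mode_xx_cont M)|apply cont_cas]. }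
  assert (E : RInt (fun x => wxx t x * cas k x + IZR k ^ 2 * (w t x * cas k x)) 0 (2 * PI) = 0).
  { rewrite (RInt_ftc (fun x => wx t x * cas k x - w t x * (IZR k * cas (- k) x))).
    - rewrite <- (Rplus_0_l (2 * PI)), !cas_periodic, (mode_periodic_x M).
      rewrite (derive_periodic (w t) (wx t)); [ring_R|apply (mode_x M)|apply (mode_periodic_x M)].
    - intro x; evar_last.
      + apply (is_derive_minus (V := R_NormedModule)).
        * apply is_derive_mult_R; [apply (mode_xx M)|apply is_derive_cas].
        * apply is_derive_mult_R; [apply (mode_x M)|apply is_derive_scal, is_derive_cas].
      + unfold minus, plus, opp; simpl. rewrite Z.opp_involutive, opp_IZR; ring.
    - apply cont_plus; [exact Cx|apply cont_mult; [apply cont_const|exact Cw]]. }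
  rewrite RInt_add, RInt_mulc in E;
    [|exact Cw|exact Cx|apply cont_mult; [apply cont_const|exact Cw]].
  unfold coef; lra.
Qed.

Lemma coef_tt k t : coef k wtt t = - (IZR k ^ 2 + lambda) * coef k w t.
Proof.
  assert (Cw : cont (fun x => w t x * cas k x))
    by (apply cont_mult; [apply mode_cont|apply cont_cas]).
  assert (Cx : cont (fun x => wxx t x * cas k x)).
  { apply cont_mult; [intro; apply continuity_2d_snd, (mode_xx_cont M)|apply cont_cas]. }
  transitivity (coef k wxx t - lambda * coef k w t); [|rewrite coef_xx; ring].
  unfold coef; rewrite <- RInt_mulc, <- RInt_sub;
    [|exact Cx|apply cont_mult; [apply cont_const|exact Cw]|exact Cw].
  apply RInt_ext_all; intro x.
  replace (wtt t x) with (wxx t x - lambda * w t x); [ring|].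
  rewrite <- (mode_eq M); ring.
Qed.

Lemma mode_coef k : 0 < lambda ->
  (forall t, coef k w t = coef k w 0 * cos (sqrt (IZR k ^ 2 + lambda) * t)
     + coef k wt 0 / sqrt (IZR k ^ 2 + lambda) * sin (sqrt (IZR k ^ 2 + lambda) * t)) /\
  ((forall j, IZR j ^ 2 <> IZR k ^ 2 + lambda) -> forall t, coef k w t = 0).
Proof.
  intros L.
  assert (P : 0 < IZR k ^ 2 + lambda) by (generalize (pow2_ge_0 (IZR k)); lra).
  set (o := sqrt (IZR k ^ 2 + lambda)).
  assert (Ho : 0 < o) by now apply sqrt_lt_R0.
  assert (Eo : o ^ 2 = IZR k ^ 2 + lambda) by (apply pow2_sqrt; lra).
  assert (D1 : forall t, is_derive (coef k w) t (coef k wt t)).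
  { intro t; apply is_derive_coef; [apply (mode_t M)|apply (mode_t_cont M)|apply mode_cont]. }
  assert (D2 : forall t, is_derive (coef k wt) t (- o ^ 2 * coef k w t)).
  { intro t; rewrite Eo, <- coef_tt; apply is_derive_coef;
      [apply (mode_tt M)|apply (mode_tt_cont M)|].
    intros s x; apply continuity_2d_snd, (mode_t_cont M). }
  split; [now apply oscillator|].
  intros N; apply (oscillator_periodic _ _ o Ho D1 D2).
  - intro t; apply RInt_ext_all; intro x; now rewrite (mode_periodic_t M).
  - intros j Hj; apply (N j); now rewrite Hj.
Qed.

(** Chosen such that [F 0 * cos (j t) + F' 0 / j * sin (j t)], with [F] the [k]-th
    coefficient, is [2 * PI] times the combination of [cas j] and [cas (- j)] with the
    amplitudes of [(j, k)] and [(- j, k)].  One formula serves both signs of [j]. *)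
Definition amplitude (p : Z * Z) : R :=
  (coef (snd p) w 0 + coef (snd p) wt 0 / IZR (fst p)) / (4 * PI).

Lemma amplitude_pair k j t : 0 < lambda -> (0 < j)%Z -> IZR j ^ 2 = IZR k ^ 2 + lambda ->
  coef k w t = 2 * PI * (amplitude (j, k) * cas j t + amplitude ((- j)%Z, k) * cas (- j) t).
Proof.
  intros L Hj E.
  assert (Pj : 0 < IZR j) by now apply (IZR_lt 0).
  destruct (mode_coef k L) as [S _]; rewrite S, <- E.
  rewrite <- Rsqr_pow2, sqrt_Rsqr by lra.
  unfold amplitude, cas; simpl; rewrite opp_IZR, Ropp_mult_distr_l_reverse, cos_neg, sin_neg.
  field; split; [lra|apply PI_neq0].
Qed.

End Mode.
Arguments amplitude w wt p : clear implicits.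

(** * Expansion of real eigenfunctions *)

Definition form (p : Z * Z) : R := IZR (fst p) ^ 2 - IZR (snd p) ^ 2.

(** Orthogonality in [x] keeps exactly the terms of frequency [k]. *)
Lemma coef_combination (d : Z * Z -> R) l k t :
  coef k (fun t x => Rsum (fun p => d p * (cas (fst p) t * cas (snd p) x)) l) t
  = 2 * PI * Rsum (fun p => d p * cas (fst p) t) (filter (fun p => (snd p =? k)%Z) l).
Proof.
  unfold coef.
  rewrite (RInt_ext_all _ (fun x => Rsum (fun p =>
             d p * cas (fst p) t * (cas (snd p) x * cas k x)) l)).
  2:{ intro x; rewrite Rmult_comm, <- Rsum_mulc; apply Rsum_ext; intros; ring. }
  rewrite RInt_Rsum.
  2:{ intro p; apply cont_mult; [apply cont_const|apply cont_mult; apply cont_cas]. }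
  rewrite <- Rsum_mulc, (Rsum_filter _ (fun p => (snd p =? k)%Z)).
  - apply Rsum_ext; intros p Hp; apply filter_In in Hp.
    destruct Hp as [_ Hp]; apply Z.eqb_eq in Hp; subst k.
    rewrite RInt_mulc by (apply cont_mult; apply cont_cas).
    rewrite cas_norm; ring.
  - intros p Hp; apply Z.eqb_neq in Hp.
    rewrite RInt_mulc by (apply cont_mult; apply cont_cas).
    rewrite cas_orth by exact Hp; ring.
Qed.

Section Basis.
Context {lambda : R} {l : list (Z * Z)} (Hl : 0 < lambda) (ND : NoDup l)
  (Spec : forall p, In p l <-> form p = lambda).

Lemma fiber_pair k j : (0 < j)%Z -> IZR j ^ 2 = IZR k ^ 2 + lambda ->
  Permutation (filter (fun p => (snd p =? k)%Z) l) ((j, k) :: ((- j)%Z, k) :: nil).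
Proof.
  intros Hj E; apply NoDup_Permutation.
  - now apply NoDup_filter.
  - repeat constructor; simpl; intuition congruence || (intuition; inversion H0; lia).
  - intros [a b]; rewrite filter_In, Spec, Z.eqb_eq; simpl; unfold form; simpl fst; simpl snd.
    split.
    + intros [F ->].
      assert (Q : IZR (a * a) = IZR (j * j)) by (rewrite !mult_IZR; lra).
      apply eq_IZR in Q.
      assert (D : a = j \/ a = (- j)%Z) by nia.
      destruct D as [->| ->]; auto.
    + intros [[= <- <-]|[[= <- <-]|[]]]; (split; [|reflexivity]).
      * lra.
      * rewrite opp_IZR; lra.
Qed.

Lemma fiber_empty k : (forall j, IZR j ^ 2 <> IZR k ^ 2 + lambda) ->
  filter (fun p => (snd p =? k)%Z) l = nil.
Proof.
  intros N; destruct (filter _ l) as [|p r] eqn:E; [reflexivity|exfalso].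
  assert (H : In p (filter (fun p => (snd p =? k)%Z) l)) by (rewrite E; now left).
  apply filter_In in H; rewrite Spec, Z.eqb_eq in H; destruct H as [F <-].
  apply (N (fst p)); unfold form in F; lra.
Qed.

(** The [k]-th coefficients in [x] of both sides agree for every [k]: for a fixed [k] the list
    contains either the two points [(j, k)] and [(- j, k)], or none, and in the latter
    case the coefficient of [w] vanishes. *)
Lemma mode_expansion w wt wtt wx wxx : real_mode lambda w wt wtt wx wxx ->
  forall t x, w t x =
    Rsum (fun p => amplitude w wt p * (cas (fst p) t * cas (snd p) x)) l.
Proof.
  intros M t x.
  set (v := fun t x => Rsum (fun p => amplitude w wt p * (cas (fst p) t * cas (snd p) x)) l).
  change (w t x = v t x).
  assert (Cw : cont (w t)) by (exact (mode_cont M t)).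
  assert (Cv : cont (v t)).
  { apply (cont_Rsum (fun p x => amplitude w wt p * (cas (fst p) t * cas (snd p) x))).
    intro p; apply cont_mult; [apply cont_const|].
    apply cont_mult; [apply cont_const|apply cont_cas]. }
  apply Rminus_diag_uniq.
  apply (no_harmonics_eq_0 (fun x => w t x - v t x)).
  - now apply cont_minus.
  - intro y; rewrite (mode_periodic_x M); f_equal.
    apply Rsum_ext; intros p _; now rewrite cas_periodic.
  - intro k.
    rewrite (RInt_ext_all _ (fun x => w t x * cas k x - v t x * cas k x)) by (intro; ring).
    rewrite RInt_sub by (apply cont_mult; [assumption|apply cont_cas]).
    change (coef k w t - coef k v t = 0).
    unfold v; rewrite coef_combination.
    destruct (classic (exists j, IZR j ^ 2 = IZR k ^ 2 + lambda)) as [[j Hj]|N].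
    + assert (Hj' : IZR (Z.abs j) ^ 2 = IZR k ^ 2 + lambda).
      { rewrite abs_IZR, pow2_abs; exact Hj. }
      assert (Pj : (0 < Z.abs j)%Z).
      { apply Z.abs_pos; intros ->; generalize (pow2_ge_0 (IZR k)); simpl in Hj; nra. }
      rewrite (Rsum_perm _ _ _ (fiber_pair k _ Pj Hj')).
      rewrite (amplitude_pair M k _ t Hl Pj Hj').
      unfold Rsum; simpl map; simpl fold_right; simpl fst; ring.
    + assert (N' : forall j, IZR j ^ 2 <> IZR k ^ 2 + lambda) by (intros j E; apply N; now exists j).
      rewrite (fiber_empty k N').
      rewrite (proj2 (mode_coef M k Hl) N'); unfold Rsum; simpl; ring.
Qed.
End Basis.

(** Integrate against [cas k x], then against [cas j t]: orthogonality leaves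
    only the term of [(j, k)]. *)
Lemma combination_zero (d : Z * Z -> R) l : NoDup l ->
  (forall t x, Rsum (fun p => d p * (cas (fst p) t * cas (snd p) x)) l = 0) ->
  forall p, In p l -> d p = 0.
Proof.
  intros ND Z [j k] Hp.
  assert (Z1 : forall t, Rsum (fun p => d p * cas (fst p) t)
                 (filter (fun p => (snd p =? k)%Z) l) = 0).
  { intro t; apply (Rmult_eq_reg_l (2 * PI)); [|generalize PI_RGT_0; lra].
    rewrite <- coef_combination, Rmult_0_r; unfold coef.
    rewrite (RInt_ext_all _ (fun _ => 0)) by (intro; rewrite Z; ring).
    rewrite RInt_const; unfold scal; simpl; unfold mult; simpl; ring_R. }
  assert (Z2 : RInt (fun t => Rsum (fun p => d p * (cas (fst p) t * cas j t))
                 (filter (fun p => (snd p =? k)%Z) l)) 0 (2 * PI) = 0).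
  { rewrite (RInt_ext_all _ (fun _ => 0)).
    - rewrite RInt_const; unfold scal; simpl; unfold mult; simpl; ring_R.
    - intro t; rewrite <- (Rmult_0_r (cas j t)), <- (Z1 t) at 1.
      rewrite <- Rsum_mulc; apply Rsum_ext; intros; ring. }
  rewrite RInt_Rsum in Z2.
  2:{ intro p; apply cont_mult; [apply cont_const|apply cont_mult; apply cont_cas]. }
  rewrite (Rsum_filter _ (fun p => (fst p =? j)%Z)) in Z2.
  2:{ intros p Hp'; apply Z.eqb_neq in Hp'.
      rewrite RInt_mulc by (apply cont_mult; apply cont_cas).
      rewrite cas_orth by exact Hp'; ring. }
  rewrite (Rsum_perm _ _ ((j, k) :: nil)) in Z2.
  - unfold Rsum in Z2; simpl in Z2.
    rewrite RInt_mulc, cas_norm in Z2 by (apply cont_mult; apply cont_cas).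
    apply (Rmult_eq_reg_r (2 * PI)); generalize PI_RGT_0; lra.
  - apply NoDup_Permutation.
    + now apply NoDup_filter, NoDup_filter.
    + repeat constructor; intros [].
    + intros [a b]; rewrite !filter_In, !Z.eqb_eq; simpl; split.
      * intros [[_ ->] ->]; auto.
      * intros [[= <- <-]|[]]; auto.
Qed.

(** * Eigenvalues and their multiplicities *)

Definition wave (c : R) (p : Z * Z) (t x : R) : C :=
  RtoC (c * (cas (fst p) t * cas (snd p) x)).

Lemma Dt_wave c j k : Dt (wave c (j, k)) = wave (c * IZR j) ((- j)%Z, k).
Proof.
  apply functional_extensionality; intro t; apply functional_extensionality; intro x.
  unfold Dt, wave, RtoC; simpl; f_equal.
  - apply is_derive_unique; evar_last.
    + apply is_derive_scal, is_derive_mult_R; [apply is_derive_cas|apply is_derive_const].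
    + unfold zero; simpl; ring.
  - apply Derive_const.
Qed.

Lemma Dx_wave c j k : Defs.Dx (wave c (j, k)) = wave (c * IZR k) (j, (- k)%Z).
Proof.
  apply functional_extensionality; intro t; apply functional_extensionality; intro x.
  unfold Defs.Dx, wave, RtoC; simpl; f_equal.
  - apply is_derive_unique; evar_last.
    + apply is_derive_scal, is_derive_scal, is_derive_cas.
    + simpl; ring.
  - apply Derive_const.
Qed.

(** Derivatives of a product wave are again product waves, so smoothness follows
    by induction on the order. *)
Lemma of_class_wave n : forall c j k, of_class n (wave c (j, k)).
Proof.
  assert (C0 : forall c j k, continuous_2d (wave c (j, k))).
  { intros c j k t x; unfold wave, RtoC; simpl; split; [|apply continuity_2d_pt_const].
    apply continuity_2d_pt_mult; [apply continuity_2d_pt_const|].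
    apply continuity_2d_pt_mult;
      [apply continuity_2d_proj1, cont_cas|apply continuity_2d_proj2, cont_cas]. }
  induction n as [|n IH]; intros c j k; [apply C0|].
  simpl; rewrite Dt_wave, Dx_wave.
  split; [apply C0|split; [|split; apply IH]].
  intros t x; unfold wave, RtoC; simpl.
  repeat split; try apply ex_derive_const; eexists.
  - apply is_derive_scal, is_derive_mult_R; [apply is_derive_cas|apply is_derive_const].
  - apply is_derive_scal, is_derive_scal, is_derive_cas.
Qed.

Lemma eigenspace_wave p : eigenspace (form p) (wave 1 p).
Proof.
  destruct p as [j k]; split; [split|].
  - intros t x; unfold wave; simpl; now rewrite !cas_periodic.
  - intro n; apply of_class_wave.
  - intros t x; unfold box.
    rewrite !Dt_wave, !Dx_wave, !Z.opp_involutive; unfold wave, form; simpl.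
    rewrite <- RtoC_opp, <- RtoC_plus, <- RtoC_mult, !opp_IZR; f_equal; ring.
Qed.

Lemma eigenspace_real_mode (pr : C -> R) lambda u : pr = Re \/ pr = Im ->
  eigenspace lambda u ->
  real_mode lambda (fun t x => pr (u t x)) (fun t x => pr (Dt u t x))
    (fun t x => pr (Dt (Dt u) t x)) (fun t x => pr (Defs.Dx u t x))
    (fun t x => pr (Defs.Dx (Defs.Dx u) t x)).
Proof.
  intros Hpr [[P S] E].
  destruct (S 2%nat) as (_ & d0 & (ct & dt & ctt & _) & (cx & dx & _ & cxx)).
  split.
  - intros t x; now rewrite (proj1 (P t x)).
  - intros t x; now rewrite (proj2 (P t x)).
  - intros t x; destruct (d0 t x) as (a & b & c & d).
    destruct Hpr as [-> | ->]; now apply Derive_correct.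
  - intros t x; destruct (dt t x) as (a & b & c & d).
    destruct Hpr as [-> | ->]; now apply Derive_correct.
  - intros t x; destruct (d0 t x) as (a & b & c & d).
    destruct Hpr as [-> | ->]; now apply Derive_correct.
  - intros t x; destruct (dx t x) as (a & b & c & d).
    destruct Hpr as [-> | ->]; now apply Derive_correct.
  - intros t x; destruct (ct t x) as (a & b); now destruct Hpr as [-> | ->].
  - intros t x; destruct (ctt t x) as (a & b); now destruct Hpr as [-> | ->].
  - intros t x; destruct (cxx t x) as (a & b); now destruct Hpr as [-> | ->].
  - intros t x; generalize (E t x); unfold box.
    destruct (Dt (Dt u) t x) as [a1 a2], (Defs.Dx (Defs.Dx u) t x) as [b1 b2], (u t x) as [c1 c2].
    unfold RtoC, Cplus, Copp, Cmult; simpl; intros [= E1 E2].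
    destruct Hpr as [-> | ->]; simpl; lra.
Qed.

Lemma map_nth_seq {A B} (g : A -> B) a0 l :
  map (fun i => g (nth i l a0)) (seq 0 (length l)) = map g l.
Proof.
  induction l as [|a l IH]; [reflexivity|].
  simpl; f_equal; rewrite <- seq_shift, map_map; exact IH.
Qed.

Definition basis (l : list (Z * Z)) (i : nat) : R -> R -> C := wave 1 (nth i l (0, 0)%Z).

Lemma lincomb_parts (c : nat -> C) b n t x :
  (forall i, snd (b i t x) = 0) ->
  lincomb n c b t x =
    (Rsum (fun i => fst (c i) * fst (b i t x)) (seq 0 n),
     Rsum (fun i => snd (c i) * fst (b i t x)) (seq 0 n)).
Proof.
  intros R0; unfold lincomb.
  induction (seq 0 n) as [|i s IH]; [reflexivity|].
  simpl; rewrite IH; unfold Cplus, Rsum, Cmult; simpl; rewrite R0; f_equal; ring.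
Qed.

Lemma Rsum_nth {A} (g : A -> R) a0 l :
  Rsum (fun i => g (nth i l a0)) (seq 0 (length l)) = Rsum g l.
Proof. unfold Rsum; now rewrite map_nth_seq. Qed.

(** Turns coefficients indexed by positions into coefficients indexed by the entries
    themselves. *)
Lemma nth_factor {A} (eq_dec : forall p q : A, {p = q} + {p <> q}) a0 (l : list A)
    (c : nat -> R) : NoDup l ->
  exists d : A -> R, forall i, (i < length l)%nat -> d (nth i l a0) = c i.
Proof.
  intros ND.
  set (index := fix index p l := match l with
                  | nil => O
                  | q :: l => if eq_dec p q then O else S (index p l) end).
  exists (fun p => c (index p l)).
  assert (I : forall l p, In p l -> (index p l < length l)%nat /\ nth (index p l) l a0 = p).
  { clear; induction l as [|q l IH]; intros p; [intros []|].
    simpl; destruct (eq_dec p q) as [->|N]; [split; [lia|reflexivity]|].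
    intros [->|H]; [now elim N|]; destruct (IH p H); split; [lia|assumption]. }
  intros i Hi; f_equal.
  destruct (I l (nth i l a0)) as [H1 H2]; [now apply nth_In|].
  apply (proj1 (NoDup_nth l a0) ND _ _ H1 Hi H2).
Qed.

(** As [lambda] is real, the real and the imaginary part of an eigenfunction solve the same
    equation; their expansions give the two components of the complex coefficients. *)
Lemma eigenspace_dimension lambda l : 0 < lambda -> NoDup l ->
  (forall p, In p l <-> form p = lambda) ->
  has_dimension (eigenspace lambda) (length l).
Proof.
  intros Hl ND Spec; exists (basis l); split; [|split].
  - intros i Hi; rewrite <- (proj1 (Spec (nth i l (0, 0)%Z)) (nth_In _ _ Hi)).
    apply eigenspace_wave.
  - intros c Zero i Hi.
    assert (Main : forall e : nat -> R,
      (forall t x, Rsum (fun i => e i * (1 * (cas (fst (nth i l (0, 0)%Z)) t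
                                 * cas (snd (nth i l (0, 0)%Z)) x))) (seq 0 (length l)) = 0) ->
      e i = 0).
    { intros e He; assert (eq_dec : forall p q : Z * Z, {p = q} + {p <> q})
        by (decide equality; apply Z.eq_dec).
      destruct (nth_factor eq_dec (0, 0)%Z l e ND) as [d Hd].
      rewrite <- (Hd i Hi); apply (combination_zero d l ND); [|now apply nth_In].
      intros t x; rewrite <- (He t x), <- (Rsum_nth _ (0, 0)%Z).
      apply Rsum_ext; intros a Ha; apply in_seq in Ha.
      rewrite Hd by lia; ring. }
    apply injective_projections; simpl;
      [apply (Main (fun i => fst (c i)))|apply (Main (fun i => snd (c i)))];
      intros t x; generalize (Zero t x); rewrite lincomb_parts by reflexivity;
      intros [= E1 E2]; assumption.
  - intros u Hu.
    assert (M1 := eigenspace_real_mode Re lambda u (or_introl eq_refl) Hu).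
    assert (M2 := eigenspace_real_mode Im lambda u (or_intror eq_refl) Hu).
    exists (fun i => (amplitude (fun t x => Re (u t x)) (fun t x => Re (Dt u t x))
                        (nth i l (0, 0)%Z),
                      amplitude (fun t x => Im (u t x)) (fun t x => Im (Dt u t x))
                        (nth i l (0, 0)%Z))).
    intros t x; rewrite lincomb_parts by reflexivity.
    apply injective_projections; simpl.
    + etransitivity; [apply (mode_expansion Hl ND Spec _ _ _ _ _ M1)|].
      rewrite <- (Rsum_nth _ (0, 0)%Z); apply Rsum_ext; intros; simpl; ring.
    + etransitivity; [apply (mode_expansion Hl ND Spec _ _ _ _ _ M2)|].
      rewrite <- (Rsum_nth _ (0, 0)%Z); apply Rsum_ext; intros; simpl; ring.
Qed.

Lemma eigenvalue_iff lambda l : 0 < lambda -> NoDup l ->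
  (forall p, In p l <-> form p = lambda) ->
  eigenvalue lambda <-> exists p, form p = lambda.
Proof.
  intros Hl ND Spec; split.
  - intros (u & Hu & t & x & Hn).
    destruct l as [|p l]; [|exists p; apply Spec; now left].
    destruct (eigenspace_dimension lambda nil Hl ND Spec) as (b & _ & _ & S).
    destruct (S u Hu) as [c Hc]; elim Hn; now rewrite Hc.
  - intros [p <-]; exists (wave 1 p); split; [apply eigenspace_wave|].
    exists 0, 0; unfold wave; rewrite !cas_0_r; intros [= E]; lra.
Qed.

(** * Lattice points between hyperbolas *)

Definition sym_range (K : Z) : list Z :=
  map (fun i => (Z.of_nat i - K)%Z) (seq 0 (Z.to_nat (2 * K + 1))).

Lemma in_sym_range K k : In k (sym_range K) <-> (Z.abs k <= K)%Z.
Proof.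
  unfold sym_range; rewrite in_map_iff; split.
  - intros (i & <- & Hi); apply in_seq in Hi; lia.
  - intros H; exists (Z.to_nat (k + K)); rewrite in_seq; lia.
Qed.

Lemma NoDup_sym_range K : NoDup (sym_range K).
Proof.
  apply FinFun.Injective_map_NoDup; [intros a b; lia|apply seq_NoDup].
Qed.

Lemma NoDup_flat_map {A B} (f : A -> list B) l : NoDup l ->
  (forall a, In a l -> NoDup (f a)) ->
  (forall a a' b, In a l -> In a' l -> In b (f a) -> In b (f a') -> a = a') ->
  NoDup (flat_map f l).
Proof.
  intros ND Hf Hd; induction ND as [|a l Ha ND IH]; [constructor|].
  simpl; apply NoDup_app.
  - apply Hf; now left.
  - apply IH; [intros; apply Hf; now right|].
    intros x y b Hx Hy; apply Hd; now right.
  - intros b Hb Hb'; apply in_flat_map in Hb'; destruct Hb' as (a' & Ha' & Hb').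
    apply Ha; rewrite (Hd a a' b); auto; [now left|now right].
Qed.

Definition points_above (a k : Z) : list (Z * Z) :=
  ((a + Z.abs k, k) :: (- (a + Z.abs k), k) :: nil)%Z.

(** The largest [k] with [a * (a + 2 * k) <= n], see [radius_spec]. *)
Definition radius (n a : Z) : Z := ((n - a * a) / (2 * a))%Z.

(** Grouping the points by [i = |j| - |k|] makes each group easy to count: [k] ranges over a
    symmetric interval, and determines [j] up to sign. *)
Definition diagonal_points (n : Z) (i : nat) : list (Z * Z) :=
  flat_map (points_above (Z.of_nat i)) (sym_range (radius n (Z.of_nat i))).

Definition lattice_points (n : Z) : list (Z * Z) :=
  flat_map (diagonal_points n) (seq 1 (Z.to_nat (Z.sqrt n))).

Lemma in_points_above a k p : (0 < a)%Z ->
  In p (points_above a k) <-> snd p = k /\ (Z.abs (fst p) = a + Z.abs k)%Z.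
Proof.
  intros Ha; destruct p as [j k']; simpl; split.
  - intros [[= <- <-]|[[= <- <-]|[]]]; lia.
  - intros [-> E]. destruct (Z.abs_eq_or_opp j) as [F|F]; [left|right; left]; f_equal; lia.
Qed.

Lemma radius_spec n a k : (0 < a)%Z -> (k <= radius n a <-> a * a + 2 * a * k <= n)%Z.
Proof.
  intros Ha; unfold radius.
  generalize (Z.div_mod (n - a * a) (2 * a) ltac:(lia))
             (Z.mod_pos_bound (n - a * a) (2 * a) ltac:(lia)).
  set (q := ((n - a * a) / (2 * a))%Z); set (r := ((n - a * a) mod (2 * a))%Z).
  intros; nia.
Qed.

Lemma in_diagonal_points n i p : (0 < i)%nat ->
  In p (diagonal_points n i) <->
  (Z.abs (fst p) - Z.abs (snd p) = Z.of_nat i /\ fst p * fst p - snd p * snd p <= n)%Z.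
Proof.
  intros Hi; assert (Ha : (0 < Z.of_nat i)%Z) by lia.
  unfold diagonal_points; rewrite in_flat_map; destruct p as [j k]; simpl fst; simpl snd.
  assert (E : (Z.abs j = Z.of_nat i + Z.abs k ->
     j * j - k * k = Z.of_nat i * Z.of_nat i + 2 * Z.of_nat i * Z.abs k)%Z).
  { intros F; rewrite <- (Z.abs_square j), <- (Z.abs_square k), F; ring. }
  split.
  - intros (k' & Hk & Hp); apply in_sym_range in Hk; rewrite radius_spec in Hk by exact Ha.
    apply in_points_above in Hp; [|exact Ha]; simpl in Hp; destruct Hp as [<- Hj].
    rewrite (E Hj); lia.
  - intros [F Hn]; exists k; rewrite in_sym_range, radius_spec, in_points_above by exact Ha.
    rewrite E in Hn by lia; simpl fst; simpl snd; lia.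
Qed.

Lemma in_lattice_points n p :
  In p (lattice_points n) <-> (0 < fst p * fst p - snd p * snd p <= n)%Z.
Proof.
  unfold lattice_points; rewrite in_flat_map; destruct p as [j k]; simpl fst; simpl snd.
  assert (E : (j * j - k * k = (Z.abs j - Z.abs k) * (Z.abs j + Z.abs k))%Z).
  { rewrite <- (Z.abs_square j), <- (Z.abs_square k); ring. }
  split.
  - intros (i & Hi & Hp); apply in_seq in Hi; rewrite in_diagonal_points in Hp by lia.
    simpl in Hp; destruct Hp as [F Hn]; split; [rewrite E|exact Hn].
    apply Z.mul_pos_pos; lia.
  - intros [Hp Hn].
    rewrite E in Hp, Hn; generalize (Z.abs_nonneg j) (Z.abs_nonneg k); intros Aj Ak.
    assert (P : (0 < Z.abs j - Z.abs k)%Z) by nia.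
    exists (Z.to_nat (Z.abs j - Z.abs k)).
    rewrite in_diagonal_points by lia; rewrite in_seq; simpl; rewrite E; split; [|lia].
    assert (Q : ((Z.abs j - Z.abs k) <= Z.sqrt n)%Z).
    { apply Z.sqrt_le_square; nia. }
    lia.
Qed.

Lemma NoDup_lattice_points n : NoDup (lattice_points n).
Proof.
  apply NoDup_flat_map; [apply seq_NoDup| |].
  - intros i Hi; apply in_seq in Hi.
    apply NoDup_flat_map; [apply NoDup_sym_range| |].
    + intros k _; constructor; [|constructor; [intros []|constructor]].
      intros [[= E]|[]]; lia.
    + intros k k' p _ _ H H'; rewrite in_points_above in H, H' by lia; intuition congruence.
  - intros i i' p Hi Hi' H H'; apply in_seq in Hi, Hi'.
    rewrite in_diagonal_points in H, H' by lia; lia.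
Qed.

Lemma form_IZR p : form p = IZR (fst p * fst p - snd p * snd p).
Proof. unfold form; rewrite minus_IZR, !mult_IZR; ring. Qed.

Lemma in_lattice_points_floor s p :
  In p (lattice_points (Zfloor s)) <-> 0 < form p <= s.
Proof.
  rewrite in_lattice_points, form_IZR; generalize (fst p * fst p - snd p * snd p)%Z; intro z.
  split; intros [H1 H2]; split.
  - now apply (IZR_lt 0).
  - apply IZR_le in H2; generalize (Zfloor_bound s); lra.
  - now apply lt_IZR.
  - now apply Zfloor_lub.
Qed.

(** * Counting eigenvalues with multiplicity *)

Definition fiber {A} (f : A -> R) (r : R) (l : list A) : list A :=
  filter (fun a => if Req_dec_T (f a) r then true else false) l.

Lemma in_fiber {A} (f : A -> R) r l a : In a (fiber f r l) <-> In a l /\ f a = r.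
Proof.
  unfold fiber; rewrite filter_In; destruct Req_dec_T; intuition congruence.
Qed.

(** Each entry of [l] lies in exactly one of the fibers. *)
Lemma list_sum_fibers {A} (f : A -> R) (l : list A) : forall ls, NoDup ls ->
  (forall a, In a l -> In (f a) ls) ->
  list_sum (map (fun r => length (fiber f r l)) ls) = length l.
Proof.
  induction l as [|a l IH]; intros ls ND H.
  - clear; induction ls; simpl; auto.
  - simpl; rewrite <- (IH ls ND) by (intros; apply H; now right).
    assert (Ha : In (f a) ls) by (apply H; now left).
    apply in_split in Ha; destruct Ha as (l1 & l2 & ->).
    apply NoDup_remove_2 in ND.
    rewrite !map_app, !list_sum_app; simpl map; simpl list_sum.
    assert (E : forall l', ~ In (f a) l' ->
       map (fun r => length (fiber f r (a :: l))) l' =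
       map (fun r => length (fiber f r l)) l').
    { intros l' N; apply map_ext_in; intros r' Hr; unfold fiber; simpl.
      destruct Req_dec_T as [<-|_]; [now elim N|reflexivity]. }
    rewrite !E by (intros N; apply ND, in_or_app; auto).
    unfold fiber at 2; simpl; destruct Req_dec_T as [_|N]; [|now elim N].
    simpl; fold (fiber f (f a) l); lia.
Qed.

(** The fiber of [form] over [lambda] indexes a basis of the eigenspace of [lambda], so the
    multiplicities add up to the number of all lattice points. *)
Lemma eigenvalue_count s :
  positive_eigenvalue_count s (length (lattice_points (Zfloor s))).
Proof.
  set (l := lattice_points (Zfloor s)).
  assert (Spec : forall lambda, 0 < lambda <= s ->
            forall p, In p (fiber form lambda l) <-> form p = lambda).
  { intros lambda Hl p; rewrite in_fiber; unfold l; rewrite in_lattice_points_floor.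
    split; [tauto|intros <-; tauto]. }
  assert (ND : forall lambda, NoDup (fiber form lambda l))
    by (intro; apply NoDup_filter, NoDup_lattice_points).
  set (ls := nodup Req_dec_T (map form l)).
  assert (In_ls : forall lambda, In lambda ls <-> exists p, form p = lambda /\ In p l).
  { intro lambda; unfold ls; rewrite nodup_In, in_map_iff; reflexivity. }
  assert (Pos : forall lambda, In lambda ls -> 0 < lambda <= s).
  { intros lambda H; apply In_ls in H; destruct H as (p & <- & H).
    now apply in_lattice_points_floor. }
  exists ls, (fun lambda => length (fiber form lambda l)).
  split; [apply NoDup_nodup|split; [|split]].
  - intro lambda; split.
    + intros H; split; [now apply Pos|].
      apply (eigenvalue_iff lambda (fiber form lambda l)); [now apply Pos|apply ND|apply Spec; now apply Pos|].
      apply In_ls in H; destruct H as (p & Hp & _); now exists p.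
    + intros [Hl He].
      apply (eigenvalue_iff lambda (fiber form lambda l)) in He;
        [|tauto|apply ND|now apply Spec].
      destruct He as [p <-]; apply In_ls; exists p; split; [reflexivity|].
      now apply in_lattice_points_floor.
  - intros lambda H; apply eigenspace_dimension; [now apply Pos|apply ND|].
    apply Spec; now apply Pos.
  - symmetry; apply list_sum_fibers; [apply NoDup_nodup|].
    intros p Hp; apply In_ls; now exists p.
Qed.

Lemma lattice_count s : has_card (lattice_set s) (length (lattice_points (Zfloor s))).
Proof.
  exists (lattice_points (Zfloor s)); split; [apply NoDup_lattice_points|split; [|reflexivity]].
  intro p; apply in_lattice_points_floor.
Qed.

(** * Harmonic numbers *)

Definition harmonic (n : nat) : R := sum_n_m (fun k => / INR k) 1 n.

Lemma harmonic_S n : harmonic (S n) = harmonic n + / INR (S n).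
Proof. unfold harmonic; rewrite sum_n_Sm by lia; reflexivity. Qed.

Lemma ln_le_sub1 y : 0 < y -> ln y <= y - 1.
Proof.
  intros H; generalize (exp_ineq1_le (ln y)); rewrite exp_ln by exact H; lra.
Qed.

Lemma ln_succ_bounds n : (0 < n)%nat ->
  / INR (S n) <= ln (INR (S n)) - ln (INR n) <= / INR n.
Proof.
  intros H; apply lt_0_INR in H.
  assert (H' : 0 < INR (S n)) by apply lt_0_INR, Nat.lt_0_succ.
  rewrite <- ln_div by assumption; split.
  - generalize (ln_le_sub1 (INR n / INR (S n)) (Rdiv_lt_0_compat _ _ H H')).
    rewrite !ln_div by assumption. rewrite S_INR in *.
    replace (INR n / (INR n + 1) - 1) with (- / (INR n + 1)) by (field; lra). lra.
  - generalize (ln_le_sub1 (INR (S n) / INR n) (Rdiv_lt_0_compat _ _ H' H)).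
    rewrite S_INR in *.
    replace ((INR n + 1) / INR n - 1) with (/ INR n) by (field; lra). lra.
Qed.

(** [H n - ln n] decreases and [H n - ln n - 1 / n] increases, both to Euler's constant,
    which therefore lies between them for every [n >= 1]. *)
Lemma harmonic_asymptotics m : (0 < m)%nat ->
  0 <= harmonic m - ln (INR m) - euler_gamma <= / INR m.
Proof.
  (* The shift by one skips the index [0], where [ln 0] is a default value. *)
  set (v := fun n => harmonic (S n) - ln (INR (S n))).
  assert (Dec : forall n, v (S n) <= v n).
  { intro n; unfold v; rewrite (harmonic_S (S n)).
    generalize (ln_succ_bounds (S n)); intros B; specialize (B ltac:(lia)); lra. }
  assert (Inc : forall n k, v n - / INR (S n) <= v (n + k)%nat - / INR (S (n + k))).
  { intros n k; induction k as [|k IH]; [rewrite Nat.add_0_r; lra|].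
    rewrite Nat.add_succ_r; eapply Rle_trans; [exact IH|].
    unfold v; rewrite (harmonic_S (S (n + k))).
    generalize (ln_succ_bounds (S (n + k))); intros B; specialize (B ltac:(lia)); lra. }
  assert (Low : forall n k, v n - / INR (S n) <= v (n + k)%nat).
  { intros n k; eapply Rle_trans; [apply (Inc n k)|].
    generalize (Rinv_0_lt_compat _ (lt_0_INR (S (n + k)) (Nat.lt_0_succ _))); lra. }
  assert (Ex : ex_finite_lim_seq v).
  { apply ex_finite_lim_seq_decr with (v O - / INR 1); [exact Dec|apply (Low O)]. }
  assert (L : is_lim_seq v euler_gamma).
  { destruct Ex as [l Hl].
    assert (E : euler_gamma = l).
    { unfold euler_gamma;
      rewrite (is_lim_seq_unique _ _ (proj2 (is_lim_seq_incr_1 _ l) Hl)); reflexivity. }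
    now rewrite E. }
  intros Hm; destruct m as [|n]; [lia|]; clear Hm; fold (v n).
  assert (Up : euler_gamma <= v n) by (apply is_lim_seq_decr_compare; assumption).
  assert (Lo : v n - / INR (S n) <= euler_gamma).
  { apply (is_lim_seq_le (fun _ => v n - / INR (S n)) (fun k => v (k + n)%nat)
             (v n - / INR (S n)) euler_gamma).
    - intro k; rewrite Nat.add_comm; apply Low.
    - apply is_lim_seq_const.
    - now apply (is_lim_seq_incr_n v n). }
  lra.
Qed.

(** * Asymptotics of the count *)

Lemma INR_list_sum {A} (g : A -> nat) l :
  INR (list_sum (map g l)) = Rsum (fun a => INR (g a)) l.
Proof.
  induction l as [|a l IH]; [reflexivity|].
  unfold Rsum in *; simpl; now rewrite plus_INR, IH.
Qed.

Lemma Rsum_dist {A} (g h : A -> R) l c :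
  (forall a, In a l -> Rabs (g a - h a) <= c) ->
  Rabs (Rsum g l - Rsum h l) <= c * INR (length l).
Proof.
  induction l as [|a l IH]; intros H.
  - unfold Rsum; simpl; rewrite Rminus_0_r, Rabs_R0; lra.
  - change (length (a :: l)) with (S (length l)); rewrite S_INR.
    change (Rabs (g a + Rsum g l - (h a + Rsum h l)) <= c * (INR (length l) + 1)).
    replace (g a + Rsum g l - (h a + Rsum h l))
      with ((g a - h a) + (Rsum g l - Rsum h l)) by ring.
    eapply Rle_trans; [apply Rabs_triang|].
    generalize (H a (or_introl eq_refl)) (IH (fun b Hb => H b (or_intror Hb))); lra.
Qed.

Lemma Rsum_diagonal_main_terms s m :
  Rsum (fun i => 2 * s / INR i - 2 * INR i + 2) (seq 1 m)
  = 2 * s * harmonic m - INR m ^ 2 + INR m.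
Proof.
  induction m as [|m IH].
  - unfold Rsum, harmonic; simpl; rewrite sum_n_m_zero by lia; unfold zero; simpl; ring.
  - rewrite seq_S, harmonic_S.
    transitivity (Rsum (fun i => 2 * s / INR i - 2 * INR i + 2) (seq 1 m)
                  + (2 * s / INR (S m) - 2 * INR (S m) + 2)).
    + unfold Rsum; rewrite map_app; simpl map.
      generalize (map (fun i => 2 * s / INR i - 2 * INR i + 2) (seq 1 m)); intro l.
      induction l as [|x l IHl]; simpl in *; [ring|rewrite IHl; ring].
    + rewrite IH, S_INR; field; generalize (pos_INR m); lra.
Qed.

Lemma length_diagonal_points n i : (0 < i)%nat -> (0 <= radius n (Z.of_nat i))%Z ->
  INR (length (diagonal_points n i)) = 4 * IZR (radius n (Z.of_nat i)) + 2.
Proof.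
  intros Hi Hr; unfold diagonal_points.
  rewrite (@flat_map_constant_length _ _ 2) by reflexivity.
  unfold sym_range; rewrite length_map, length_seq, mult_INR, INR_IZR_INZ, Z2Nat.id by lia.
  rewrite plus_IZR, mult_IZR; simpl; ring.
Qed.

(** The exact count is [4 * K + 2] where the integer [K] satisfies
    [2 * K + a <= s / a <= 2 * K + a + 2], [a = i]. *)
Lemma diagonal_points_estimate s i : 0 <= s -> (0 < i)%nat -> (Z.of_nat i * Z.of_nat i <= Zfloor s)%Z ->
  Rabs (INR (length (diagonal_points (Zfloor s) i)) - (2 * s / INR i - 2 * INR i + 2)) <= 4.
Proof.
  intros Hs Hi Hn; set (n := Zfloor s) in *; set (a := Z.of_nat i) in *.
  assert (Ha : (0 < a)%Z) by (unfold a; lia).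
  assert (K0 : (0 <= radius n a)%Z) by (apply radius_spec; [exact Ha|lia]).
  rewrite length_diagonal_points by assumption; fold a.
  set (K := radius n a) in *.
  assert (U : (a * a + 2 * a * K <= n)%Z) by (apply radius_spec; [exact Ha|unfold K; lia]).
  assert (V : (n + 1 <= a * a + 2 * a * (K + 1))%Z).
  { destruct (Z_lt_le_dec n (a * a + 2 * a * (K + 1))) as [L|L]; [lia|].
    apply radius_spec in L; [unfold K in L; lia|exact Ha]. }
  apply IZR_le in U; rewrite !plus_IZR, !mult_IZR in U.
  apply IZR_le in V.
  rewrite !plus_IZR, !mult_IZR, !plus_IZR in V.
  generalize (Zfloor_bound s); fold n; intros B.
  rewrite INR_IZR_INZ; fold a.
  assert (Pa : 0 < IZR a) by now apply (IZR_lt 0).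
  assert (E1 : 2 * IZR K + IZR a <= s / IZR a).
  { apply (Rmult_le_reg_r (IZR a)); [exact Pa|].
    unfold Rdiv; rewrite Rmult_assoc, Rinv_l by lra; nra. }
  assert (E2 : s / IZR a <= 2 * IZR K + IZR a + 2).
  { apply (Rmult_le_reg_r (IZR a)); [exact Pa|].
    unfold Rdiv; rewrite Rmult_assoc, Rinv_l by lra; nra. }
  unfold Rdiv in *; rewrite Rmult_assoc; apply Rabs_le; lra.
Qed.

Lemma count_estimate s : 0 <= s -> let m := Z.to_nat (Z.sqrt (Zfloor s)) in
  Rabs (INR (length (lattice_points (Zfloor s)))
        - (2 * s * harmonic m - INR m ^ 2 + INR m)) <= 4 * INR m.
Proof.
  intros Hs m; unfold lattice_points; rewrite length_flat_map, INR_list_sum.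
  rewrite <- Rsum_diagonal_main_terms; fold m.
  rewrite <- (length_seq m 1) at 3.
  apply Rsum_dist; intros i Hi; apply in_seq in Hi.
  apply diagonal_points_estimate; [exact Hs|lia|].
  apply Z.sqrt_le_square; [|lia|unfold m in Hi; lia].
  now apply Zfloor_lub.
Qed.

(** With [m] the integer part of [sqrt s], so that [s / m <= 4 * m], the remainder is the sum of
    the counting error (at most [4 * m]), [2 * s * (H m - ln m - euler_gamma)] (at most
    [8 * m]), [s * (2 * ln m - ln s)] (at most [12 * m] in absolute value), [s - m ^ 2]
    (at most [2 * m + 1]) and [m]. *)
Lemma remainder_bound s : 1 <= s ->
  Rabs (INR (length (lattice_points (Zfloor s)))
        - (s * ln s + (2 * euler_gamma - 1) * s)) <= 28 * sqrt s.
Proof.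
  intros Hs.
  assert (F1 : (1 <= Zfloor s)%Z) by now apply Zfloor_lub.
  generalize (count_estimate s ltac:(lra)); cbv zeta.
  set (m := Z.to_nat (Z.sqrt (Zfloor s))).
  assert (Em : IZR (Z.sqrt (Zfloor s)) = INR m).
  { unfold m; rewrite INR_IZR_INZ, Z2Nat.id by apply Z.sqrt_nonneg; reflexivity. }
  assert (m1 : 1 <= INR m).
  { rewrite <- Em; apply (IZR_le 1), Z.sqrt_le_square; lia. }
  assert (Hm : (0 < m)%nat) by (apply INR_lt; simpl; lra).
  generalize (Zfloor_bound s); intros B.
  assert (Lo : INR m * INR m <= s).
  { generalize (proj1 (Z.sqrt_spec (Zfloor s) ltac:(lia))); intros Q.
    apply IZR_le in Q; rewrite mult_IZR, Em in Q; lra. }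
  assert (Hi : s < (INR m + 1) * (INR m + 1)).
  { generalize (proj2 (Z.sqrt_spec (Zfloor s) ltac:(lia))); intros Q.
    apply Zlt_le_succ, IZR_le in Q; unfold Z.succ in Q.
    rewrite plus_IZR, mult_IZR, plus_IZR, Em in Q; lra. }
  assert (Sq : INR m <= sqrt s).
  { rewrite <- (sqrt_square (INR m)) by lra; now apply sqrt_le_1_alt. }
  generalize (harmonic_asymptotics m Hm); intros [G0 G1].
  assert (Q : s * / INR m <= 4 * INR m).
  { apply (Rmult_le_reg_r (INR m)); [lra|].
    rewrite Rmult_assoc, Rinv_l by lra; nra. }
  assert (Pm : 0 < INR m * INR m) by nra.
  assert (L0 : 0 <= ln s - 2 * ln (INR m)).
  { replace (2 * ln (INR m)) with (ln (INR m * INR m)) by (rewrite ln_mult; lra).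
    destruct Lo as [Lo| ->]; [apply ln_increasing in Lo; lra|lra]. }
  assert (L1 : ln s - 2 * ln (INR m) <= 3 * / INR m).
  { replace (2 * ln (INR m)) with (ln (INR m * INR m)) by (rewrite ln_mult; lra).
    rewrite <- ln_div by lra.
    eapply Rle_trans; [apply ln_le_sub1, Rdiv_lt_0_compat; lra|].
    apply (Rmult_le_reg_r (INR m * INR m)); [exact Pm|].
    replace ((s / (INR m * INR m) - 1) * (INR m * INR m)) with (s - INR m * INR m)
      by (field; lra).
    replace (3 * / INR m * (INR m * INR m)) with (3 * INR m) by (field; lra).
    lra. }
  assert (T1 : 0 <= s * (harmonic m - ln (INR m) - euler_gamma) <= 4 * INR m) by nra.
  assert (T2 : 0 <= s * (ln s - 2 * ln (INR m)) <= 12 * INR m) by nra.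
  intros X; apply Rabs_le_between in X; apply Rabs_le.
  nra.
Qed.

Theorem theorem3p2 :
  exists (N : R -> nat) (RN : R -> R),
    (forall s : R, positive_eigenvalue_count s (N s)) /\
    (forall s : R, has_card (lattice_set s) (N s)) /\
    (forall s : R, 0 < s ->
       INR (N s) = s * ln s + (2 * euler_gamma - 1) * s + RN s) /\
    (exists K s0 : R, forall s : R, s0 <= s -> Rabs (RN s) <= K * sqrt s).
Proof.
  exists (fun s => length (lattice_points (Zfloor s))).
  exists (fun s => INR (length (lattice_points (Zfloor s)))
                   - (s * ln s + (2 * euler_gamma - 1) * s)).
  split; [exact eigenvalue_count|split; [exact lattice_count|split]].
  - intros s _; ring.
  - exists 28, 1; exact remainder_bound.
Qed.
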